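(* Let $\kappa$ be a Mahlo cardinal and let $\lambda,\lambda'$ be cardinals with $\kappa\le\lambda<\lambda'$. Suppose $S\subseteq\mathcal{P}_\kappa\lambda$. Then $S$ is $1$-stationary in $\mathcal{P}_\kappa\lambda$ if and only if $S\uparrow\lambda'$ is $1$-stationary in $\mathcal{P}_\kappa\lambda'$.
   Context: For a set $A$, $\mathcal{P}_\kappa A=\{x\subseteq A:|x|<\kappa\}$. A weakly inaccessible cardinal is an uncountable regular limit cardinal. A Mahlo cardinal is a strongly inaccessible cardinal in which the set of smaller inaccessible cardinals is stationary. For a weakly inaccessible $\kappa$ and $A\supseteq\kappa$: a set $S\subseteq\mathcal{P}_\kappa A$ is unbounded ($0$-stationary) in $\mathcal{P}_\kappa A$ if for every $x\in\mathcal{P}_\kappa A$ there is $y\in S$ with $x\subseteq y$. $S\subseteq\mathcal{P}_\kappa A$ is $1$-stationary in $\mathcal{P}_\kappa A$ if for every unbounded $T\subseteq\mathcal{P}_\kappa A$ there is $x\in S$ such that $\mu:=x\cap\kappa$ is a weakly inaccessible cardinal and $T\cap\mathcal{P}_\mu x$ is unbounded in $\mathcal{P}_\mu x$. For $\kappa\subseteq A\subseteq B$ and $S\subseteq\mathcal{P}_\kappa A$, $S\uparrow B:=\{y\in\mathcal{P}_\kappa B: y\cap A\in S\}$; here $S\uparrow\lambda'$ is taken with $A=\lambda$, $B=\lambda'$. *)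

(* Defs.v *)
From mathcomp Require Import all_boot all_order.
From mathcomp Require Import boolp classical_sets functions cardinality wochoice.

Set Implicit Arguments.
Unset Strict Implicit.
Unset Printing Implicit Defensive.

Import Order.TTheory.

Local Open Scope classical_set_scope.
Local Open Scope order_scope.
Local Open Scope card_scope.

(* Ordinals are the elements of a well-ordered type [L] (the well-ordering is *)
(* a hypothesis of the theorem); as for von Neumann ordinals, the ordinal [a] *)
(* is identified with [below a], the set of the smaller ordinals.             *)

Definition card_lt (T U : Type) (A : set T) (B : set U) : Prop :=
  (A #<= B) /\ ~ (B #<= A).

Section Ordinals.
Context {d : Order.disp_t} {L : orderType d}.
Implicit Types (a b c k m n : L) (A B C x y : set L) (S T : set (set L)).

Definition below a : set L := [set b | b < a].

Definition is_cardinal a : Prop := forall b, b < a -> ~ (below a #= below b).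

Definition uncountable a : Prop := ~ countable (below a).

Definition cofinal_map a k (f : L -> L) : Prop :=
  (forall b, b < a -> f b < k) /\
  (forall c, c < k -> exists2 b, b < a & c <= f b).

(* cf(k) = k: no ordinal a < k carries a map cofinal in k *)
Definition regular_cardinal k : Prop :=
  [/\ is_cardinal k, infinite_set (below k) &
      forall a, a < k -> ~ exists f, cofinal_map a k f].

Definition limit_cardinal k : Prop :=
  is_cardinal k /\
  forall m, is_cardinal m -> m < k -> exists n, [/\ is_cardinal n, m < n & n < k].

Definition strong_limit_cardinal k : Prop :=
  is_cardinal k /\
  forall m, is_cardinal m -> m < k ->
    card_lt [set x : set L | x `<=` below m] (below k).

Definition weakly_inaccessible k : Prop :=
  [/\ uncountable k, regular_cardinal k & limit_cardinal k].

Definition strongly_inaccessible k : Prop :=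
  [/\ uncountable k, regular_cardinal k & strong_limit_cardinal k].

Definition cofinal_in k C : Prop :=
  forall b, b < k -> exists c, [/\ C c, b < c & c < k].

(* [cofinal_in a C] is strict, so for nonzero [a] it forces [a] to be a limit *)
Definition closed_in k C : Prop :=
  forall a, a < k -> below a !=set0 -> cofinal_in a C -> C a.

Definition club k C : Prop :=
  [/\ C `<=` below k, cofinal_in k C & closed_in k C].

Definition stationary k A : Prop :=
  A `<=` below k /\ forall C, club k C -> A `&` C !=set0.

Definition mahlo k : Prop :=
  strongly_inaccessible k /\
  stationary k [set m | m < k /\ strongly_inaccessible m].

Definition Pk k A : set (set L) := [set x | x `<=` A /\ card_lt x (below k)].

Definition unbounded k A S : Prop :=
  S `<=` Pk k A /\
  forall x, Pk k A x -> exists2 y, S y & x `<=` y.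

Definition one_stationary k A S : Prop :=
  S `<=` Pk k A /\
  forall T, unbounded k A T ->
    exists2 x, S x &
      exists m, [/\ x `&` below k = below m, weakly_inaccessible m &
                    unbounded m x (T `&` Pk m x)].

Definition lift_Pk k A B S : set (set L) := [set y | Pk k B y /\ S (y `&` A)].

End Ordinals.

(* Main.v *)
Require Import Defs.
From mathcomp Require Import all_boot all_order.
From mathcomp Require Import boolp classical_sets functions cardinality wochoice.

(** Upward direction. Let [T] be unbounded in [P_kappa lambda'] and let [F w] be
    a small set that contains an element of [T] covering [w] together with an
    ordinal below [kappa] bounding its cardinality. Since [kappa] is Mahlo, the
    small sets [C] that are closed under [F] on subsets of size less than
    [nu], where [C] meets [kappa] in [nu], are cofinal in [P_kappa lambda'].
    Their traces on [lambda] thus form an unbounded family [T'], which reflects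
    at some [x] in [S], with [x] meeting [kappa] in [mu]. Taking [hull t] to be
    the least closed set containing [t], which is monotone in [t] and adds
    nothing below [lambda] when [t] is in [T'], the union [y] of the hulls of
    the members of [T'] in [P_mu x] satisfies [y] meets [lambda] in [x], and
    [F] maps [P_mu y] to subsets of [y] whose chosen members of [T] have size
    less than [mu]; hence [T] reflects at [y].

    Downward direction. An unbounded [T] lifts to an unbounded family, and
    reflection of the lift at [y] projects to reflection of [T] at the trace of
    [y] on [lambda]. *)

Set Implicit Arguments.
Unset Strict Implicit.
Unset Printing Implicit Defensive.

Import Order.TTheory.

Local Open Scope order_scope.
Local Open Scope classical_set_scope.
Local Open Scope card_scope.

(** * Cardinal comparison through injections *)

Lemma card_le_inj (T U : Type) (u0 : U) (A : set T) (B : set U) :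
  A #<= B -> exists f : T -> U,
    (forall x, A x -> B (f x)) /\ {in A &, injective f}.
Proof.
move=> /card_leP[f]; exists (valLR u0 f); split=> [x Ax|].
  exact: (@funS _ _ A B (valLR u0 f)).
exact: (@inj _ _ A (valLR u0 f)).
Qed.

Lemma inj_card_leP (T U : Type) (A : set T) (B : set U) (f : T -> U) :
  (forall x, A x -> B (f x)) -> {in A &, injective f} -> A #<= B.
Proof.
move=> fAB finj; apply: (@card_le_trans _ _ _ (f @` A)).
  by rewrite (card_le_eql (card_esym (inj_card_eq finj))).
by apply: subset_card_le => _ [x Ax <-]; exact: fAB.
Qed.

(** The injection is reversed on its range; the value [t0] taken elsewhere may lie outside [A],
    hence an inclusion only. *)
Lemma card_le_sub_image (T U : Type) (t0 : T) (A : set T) (B : set U) :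
  A #<= B -> exists g : U -> T, A `<=` g @` B.
Proof.
have [->|/set0P[u0 _]] := eqVneq B set0.
  by rewrite card_le0 => /eqP ->; exists (fun=> t0); exact: sub0set.
move=> /(card_le_inj u0)[f [fAB finj]].
have /choice[g gP] u : exists t, forall x, A x -> f x = u -> t = x.
  have [[x [Ax <-]]|no] := pselect (exists x, A x /\ f x = u).
    by exists x => y Ay /esym/finj -> //; rewrite inE.
  by exists t0 => x Ax fx; case: no; exists x.
by exists g => x Ax; exists (f x); [exact: fAB|exact: gP].
Qed.

Lemma card_le_powerset (T U : Type) (u0 : U) (A : set T) (B : set U) :
  A #<= B -> [set X | X `<=` A] #<= [set Y | Y `<=` B].
Proof.
move=> /(card_le_inj u0)[f [fAB finj]].
apply: (inj_card_leP (f := fun X => f @` X)) => [X XA _ [x Xx <-]|X Y].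
  exact/fAB/XA.
rewrite !inE /= => XA YA /seteqP[XY YX]; apply/seteqP; split=> x Xx.
  have [|y Yy /finj yx] := XY (f x); first by exists x.
  by rewrite -yx // inE; [apply: YA|apply: XA].
have [|y Yy /finj yx] := YX (f x); first by exists x.
by rewrite -yx // inE; [apply: XA|apply: YA].
Qed.

(** * Well-ordered types and the Mostowski collapse *)

Section WellOrdered.
Context {d : Order.disp_t} {L : orderType d}.
Hypothesis wo_L : well_order (<=%O : rel L).
Implicit Types (a b c k m n : L) (A B X Y : set L).

Lemma ex_min (P : set L) : P !=set0 -> exists2 m, P m & forall b, P b -> m <= b.
Proof.
move=> [x Px]; have [|m [[Pm mP] _]] := wo_L (A := [pred x | `[<P x>]]).
  by exists x; apply/asboolP.
exists m; first exact/asboolP.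
by move=> b Pb; apply: mP; apply/asboolP.
Qed.

Lemma wf_lt : well_founded (fun a b : L => a < b).
Proof.
move=> a; apply: contrapT => nacc.
have [m nm mP] := @ex_min [set b | ~ Acc (fun a b : L => a < b) b] (ex_intro _ a nacc).
apply: nm; constructor=> b bm; apply: contrapT => /mP.
by rewrite leNgt bm.
Qed.

Section Collapse.
Variable X : set L.

(* Mostowski collapse of [X]: each [x] goes to the least strict upper bound of *)
(* the images of the elements of [X] below [x].                               *)
Let body (x : L) (rec : forall y, y < x -> L) : L :=
  xget x [set c | (forall y (yx : y < x), X y -> rec y yx < c) /\
                  forall c', (forall y (yx : y < x), X y -> rec y yx < c') ->
                  c <= c'].

Definition collapse : L -> L := Fix wf_lt _ body.

Lemma collapseE x : collapse x = @body x (fun y _ => collapse y).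
Proof.
apply: (Fix_eq wf_lt (fun=> L) body) => {}x f g fg.
suff -> : f = g by [].
by apply: functional_extensionality_dep => y;
   apply: functional_extensionality_dep => p; exact: fg.
Qed.

Lemma collapseP x : [/\ collapse x <= x,
  forall y, y < x -> X y -> collapse y < collapse x &
  forall c, (forall y, y < x -> X y -> collapse y < c) -> collapse x <= c].
Proof.
elim/(well_founded_ind wf_lt): x => x IH.
have xb y : y < x -> X y -> collapse y < x.
  by move=> yx _; have [/le_lt_trans->] := IH _ yx.
have [m mb mP] := @ex_min [set c | forall y, y < x -> X y -> collapse y < c]
  (ex_intro _ x xb).
have [] : [set c | (forall y (yx : y < x), X y -> collapse y < c) /\
    forall c', (forall y (yx : y < x), X y -> collapse y < c') -> c <= c']
    (collapse x).
  by rewrite [X in _ X]collapseE; apply: xgetPex; exists m; split.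
by move=> h1 h2; split=> //; apply: h2.
Qed.

Lemma collapse_inj : {in X &, injective collapse}.
Proof.
move=> x y; rewrite !inE => Xx Xy e.
have [xy|yx|//] := ltgtP x y.
  by have [_ /(_ x xy Xx)] := collapseP y; rewrite e ltxx.
by have [_ /(_ y yx Xy)] := collapseP x; rewrite e ltxx.
Qed.

Lemma collapse_initial x c :
  c < collapse x -> exists2 y, X y & collapse y = c.
Proof.
elim/(well_founded_ind wf_lt): x => x IH cx.
have [_ _ mP] := collapseP x.
have : ~ (forall y, y < x -> X y -> collapse y < c).
  by move=> /mP; rewrite leNgt cx.
move=> /existsNP[y /not_implyP[yx /not_implyP[Xy /negP]]].
rewrite -leNgt le_eqVlt => /orP[/eqP->|cy]; first by exists y.
exact: IH cy.
Qed.

End Collapse.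

(** The collapse of [X] is an initial segment: it covers [below k], or it misses some [c < k] and
    then stays below [c]. *)
Lemma card_le_below X k :
  below k #<= X \/ exists2 c, c < k & X #<= below c.
Proof.
have [sub|] := pselect (below k `<=` collapse X @` X).
  left; apply: card_le_trans (subset_card_le sub) _; exact: card_image_le.
move=> /existsNP[c /not_implyP[ck nc]]; right; exists c => //.
apply: (inj_card_leP (f := collapse X)) => [x Xx|]; last exact: collapse_inj.
rewrite /below /= ltNge le_eqVlt; apply/negP => /orP[/eqP e|cx].
  by apply: nc; exists x.
by have [y Xy yc] := collapse_initial cx; apply: nc; exists y.
Qed.

(** * Sets of size less than a given cardinal *)

Definition small (T : Type) k (A : set T) : Prop := ~ (below k #<= A).

Lemma below_le a b : a <= b -> below a `<=` below b.
Proof. by move=> ab c /= /lt_le_trans; apply. Qed.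

Lemma small_le (T U : Type) k (A : set T) (B : set U) :
  A #<= B -> small k B -> small k A.
Proof. by move=> AB kB kA; exact: kB (card_le_trans kA AB). Qed.

Lemma small_subset (T : Type) k (A B : set T) :
  A `<=` B -> small k B -> small k A.
Proof. by move=> /subset_card_le; exact: small_le. Qed.

Lemma small_image (T U : Type) k (f : T -> U) (A : set T) :
  small k A -> small k (f @` A).
Proof. exact/small_le/card_image_le. Qed.

Lemma small_ex k X : small k X -> exists2 c, c < k & X #<= below c.
Proof. by have [] := card_le_below X k. Qed.

(** Smallness is stated negatively because that form passes directly to subsets and images; the
    dichotomy [card_le_below] recovers the embedding into [below k]. *)
Lemma card_ltE k X : card_lt X (below k) <-> small k X.
Proof.
split=> [[]//|kX]; split=> //; have [c ck Xc] := small_ex kX.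
exact: card_le_trans Xc (subset_card_le (below_le (ltW ck))).
Qed.

Lemma small_below k a : is_cardinal k -> a < k -> small k (below a).
Proof.
move=> kcard ak ka; apply: (kcard _ ak).
by rewrite card_eq_le ka; exact: subset_card_le (below_le (ltW ak)).
Qed.

Lemma small_finite (T : Type) k (A : set T) :
  infinite_set (below k) -> finite_set A -> small k A.
Proof. by move=> kinf Afin kA; apply: kinf; exact: card_le_finite kA Afin. Qed.

(** [X] is indexed by some [a < k]; were it unbounded, the indexing would give a cofinal map,
    against regularity. *)
Lemma small_bounded k X : regular_cardinal k -> X `<=` below k -> small k X ->
  exists2 b, b < k & X `<=` below b.
Proof.
move=> [kcard kinf kreg] Xk kX.
have [/eqP X0|/set0P[x0 Xx0]] := eqVneq X set0.
  have [k0|/set0P[b bk]] := eqVneq (below k) set0.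
    by exfalso; apply: kinf; rewrite k0.
  by exists b => //; move/eqP: X0 => ->; exact: sub0set.
have [a ak Xa] := small_ex kX.
have [g Xg] := card_le_sub_image x0 Xa.
(* [g] may leave [k]; such values are replaced by [x0], an element of [X]. *)
pose f b := if `[< g b < k >] then g b else x0.
have fk b : f b < k by rewrite /f; case: asboolP => // _; exact: Xk.
apply: contrapT => nb; apply: (kreg a ak); exists f; split=> // c ck.
apply: contrapT => nc; apply: nb; exists c => // x Xx.
have [b ba gb] := Xg x Xx; rewrite /below /= ltNge; apply/negP => cx.
by apply: nc; exists b => //; rewrite /f gb; case: asboolP => // /(_ (Xk _ Xx)).
Qed.

Lemma regular_limit k b : regular_cardinal k -> b < k -> exists2 c, b < c & c < k.
Proof.
move=> kreg bk; have [_ kinf _] := kreg.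
have [||c ck bc] := @small_bounded k [set b] kreg; first by move=> _ ->.
  exact/small_finite/finite_set1.
by exists c => //; exact: bc.
Qed.

(* An injection of [k] into the union would cut [k] into few pieces, each      *)
(* small, hence bounded in [k]; so no cardinal multiplication is needed.       *)
Lemma small_bigcup (I : Type) k (D : set I) (F : I -> set L) :
  regular_cardinal k -> small k D -> (forall i, D i -> small k (F i)) ->
  small k (\bigcup_(i in D) F i).
Proof.
move=> kreg kD kF kU; have [_ kinf _] := kreg.
have [k0|/set0P[l0 l0k]] := eqVneq (below k) set0.
  by apply: kinf; rewrite k0.
have [h [hU hinj]] := card_le_inj l0 kU.
pose B i := [set b | b < k /\ F i (h b)].
have /choice[c cP] i : exists c, D i -> c < k /\ B i `<=` below c.
  have [Di|nDi] := pselect (D i); last by exists l0.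
  have [||c ck Bc] := @small_bounded k (B i) kreg; first by move=> b [].
    apply: small_le (kF _ Di); apply: (inj_card_leP (f := h)) => [b []//|].
    by move=> x y; rewrite !inE => -[xk _] [yk _]; apply: hinj; rewrite inE.
  by exists c.
have [||b bk cb] := @small_bounded k (c @` D) kreg.
- by move=> _ [i Di <-]; have [] := cP _ Di.
- exact: small_image.
have [i Di hi] := hU b bk; have [_ Bc] := cP _ Di.
have /= bci : b < c i by apply: Bc.
have /= : c i < b by apply: cb; exists i.
by move=> /(lt_trans bci); rewrite ltxx.
Qed.

Lemma small_setU k A B : regular_cardinal k -> small k A -> small k B ->
  small k (A `|` B).
Proof.
move=> kreg kA kB; have [_ kinf _] := kreg.
have -> : A `|` B = \bigcup_(b in [set: bool]) if b then A else B.
  apply/seteqP; split=> [x [Ax|Bx]|x [[] _ ?]].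
  - by exists true.
  - by exists false.
  - by left.
  - by right.
apply: small_bigcup => // [|[] //]; exact: small_finite.
Qed.

(** Limit and strong limit hypotheses speak only of cardinals, so ordinal bounds are first replaced
    by equinumerous cardinals. *)
Lemma ex_cardinal a : exists m, [/\ is_cardinal m, m <= a & below a #<= below m].
Proof.
have [m ma mP] := @ex_min [set m | below a #<= below m] (ex_intro _ a (card_lexx _)).
exists m; split=> // [b bm mb|]; last exact/mP/card_lexx.
have /mP : below a #<= below b by apply: card_le_trans ma _; move: mb; rewrite card_eq_le => /andP[].
by rewrite leNgt bm.
Qed.

Lemma limit_cardinal_small k X : limit_cardinal k -> small k X ->
  exists2 n, n < k & card_lt X (below n).
Proof.
move=> [_ klim] /small_ex[c ck Xc].
have [m [mcard mc cm]] := ex_cardinal c.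
have [n [ncard mn nk]] := klim _ mcard (le_lt_trans mc ck).
exists n => //; apply/card_ltE; apply: small_le (small_below ncard mn).
exact: card_le_trans Xc cm.
Qed.

Lemma small_powerset k X : strong_limit_cardinal k -> small k X ->
  small k [set w | w `<=` X].
Proof.
move=> [_ klim] /small_ex[c ck Xc].
have [m [mcard mc cm]] := ex_cardinal c.
have [_ kP] := klim _ mcard (le_lt_trans mc ck).
apply: small_le kP; apply: (card_le_powerset k).
exact: card_le_trans Xc cm.
Qed.

Lemma ex_sup k X : regular_cardinal k -> X `<=` below k -> small k X ->
  exists c, [/\ c < k, forall x, X x -> x <= c &
                forall b, b < c -> exists2 x, X x & b < x].
Proof.
move=> kreg Xk kX; have [b bk Xb] := small_bounded kreg Xk kX.
have [c Xc cP] := @ex_min [set c | forall x, X x -> x <= c]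
  (ex_intro _ b (fun x Xx => ltW (Xb x Xx))).
exists c; split=> // [|e ec].
  by apply: le_lt_trans bk; apply: cP => x /Xb/ltW.
apply: contrapT => ne; have /cP : forall x, X x -> x <= e.
  by move=> x Xx; rewrite leNgt; apply/negP => ex; apply: ne; exists x.
by rewrite leNgt ec.
Qed.

(** * Closing a set under [F] in stages, and a club of stages *)

Section Tower.
Variables (F : set L -> set L) (z : set L).

(* An inductive predicate instead of a transfinite recursion: continuity at    *)
(* limits comes for free.                                                      *)
Inductive tower : L -> L -> Prop :=
| tower_base a u : z u -> tower a u
| tower_below a u : u < a -> tower a u
| tower_step a b w u : b < a -> w `<=` tower b -> F w u -> tower a u.

Lemma tower_le a b : a <= b -> tower a `<=` tower b.
Proof.
move=> ab u tau; case: tau ab => {a u} [a u zu|a u ua|a e w u ea we Fu] ab.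
- exact: tower_base.
- exact/tower_below/(lt_le_trans ua).
- exact: tower_step (lt_le_trans ea ab) we Fu.
Qed.

(** Each constructor refers to at most one ordinal below [a]; at a limit there is room for it at an
    earlier stage. *)
Lemma tower_limit a u : below a !=set0 ->
  (forall b, b < a -> exists2 c, b < c & c < a) ->
  tower a u -> exists2 c, c < a & tower c u.
Proof.
move=> a0 alim tau.
case: tau a0 alim => {a u} [a u zu|a u ua|a e w u ea we Fu] [c ca] alim.
- by exists c => //; exact: tower_base.
- by have [e ue ea] := alim u ua; exists e => //; exact: tower_below.
- by have [f ef fa] := alim e ea; exists f => //; exact: tower_step ef we Fu.
Qed.

Lemma tower_sub k B a : z `<=` B -> (forall w, F w `<=` B) -> below k `<=` B ->
  a < k -> tower a `<=` B.
Proof.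
move=> zB FB kB ak u tau; case: tau ak => {a u} [a u zu|a u ua|a e w u _ _ Fu] ak.
- exact: zB.
- by apply: kB; exact: lt_trans ak.
- exact: FB Fu.
Qed.

(** Stage [a] consists of [z], [below a] and the values of [F] on subsets of earlier stages; a
    strong limit makes such subsets few, and regularity keeps the union small. *)
Lemma tower_small k a : strongly_inaccessible k -> small k z ->
  (forall w, small k (F w)) -> a < k -> small k (tower a).
Proof.
move=> [_ kreg klim] kz kF; elim/(well_founded_ind wf_lt): a => a IH ak.
have kcard : is_cardinal k by case: kreg.
apply: (@small_subset _ _ _ ((z `|` below a) `|`
    \bigcup_(b in below a) \bigcup_(w in [set w | w `<=` tower b]) F w)).
  move=> u tau; case: tau IH ak => {a u} [a u zu|a u ua|a e w u ea we Fu] _ _.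
  - by left; left.
  - by left; right.
  - by right; exists e => //; exists w.
apply: small_setU => //; first by apply: small_setU => //; exact: small_below.
apply: small_bigcup => // [|b ba]; first exact: small_below.
apply: small_bigcup => //; apply: small_powerset => //.
exact: IH (lt_trans ba ak).
Qed.

(** Since stage [a] contains [below a], these are the stages that meet [below k] in exactly
    [below a]. *)
Definition tower_fixpoints k : set L :=
  [set a | a < k /\ tower a `&` below k `<=` below a].

Lemma tower_fixpoints_club k : strongly_inaccessible k -> small k z ->
  (forall w, small k (F w)) -> club k (tower_fixpoints k).
Proof.
move=> kinacc kz kF; have [kunc kreg _] := kinacc; split=> [a []//|b bk|].
  have /choice[g gP] a : exists c, a < k ->
      [/\ c < k, a < c & tower a `&` below k `<=` below c].
    have [ak|nak] := pselect (a < k); last by exists a => /nak.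
    have [||c ck tc] := @small_bounded k (tower a `&` below k) kreg.
    - by move=> u [].
    - by apply: small_subset (tower_small kinacc kz kF ak) => u [].
    have [e ae ek] := regular_limit kreg ak.
    exists (Order.max c e) => _; split; first by rewrite gt_max ck ek.
      by rewrite lt_max ae orbT.
    by move=> u /tc uc; rewrite /below /= lt_max uc.
  (* The supremum of the [g]-iterates of [b] is a fixed point, since a limit stage is the union of
     the earlier ones. *)
  pose s (i : nat) := iter i g b.
  have sk i : s i < k by elim: i => //= i IH; have [] := gP _ IH.
  have [||c [ck sc cs]] := @ex_sup k (range s) kreg.
  - by move=> _ [n _ <-]; exact: sk.
  (* [k] is uncountable, so a countable range is small. *)
  - exact: small_image.
  have {}sc i : s i < c.
    have [_ sS _] := gP _ (sk i); apply: lt_le_trans sS _.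
    by apply: sc; exists i.+1.
  exists c; split=> //; last exact: (sc 0%N).
  split=> // u [tcu uk].
  have clim e : e < c -> exists2 i, e < s i & s i < c.
    by move=> /cs[_ [n _ <-] esn]; exists n.
  have [||e ec teu] := tower_limit _ _ tcu; first by exists b; exact: (sc 0%N).
    by move=> e /clim[n en nc]; exists (s n).
  have [n en _] := clim e ec; have [_ _ tg] := gP _ (sk n).
  apply: lt_trans (sc n.+1); apply: tg; split=> //.
  exact: tower_le (ltW en) _ teu.
move=> a ak a0 cof; split=> // u [tau uk].
have [|e ea teu] := tower_limit a0 _ tau.
  by move=> b /cof[c [_ bc ca]]; exists c.
have [c [[_ cfix] ec ca]] := cof e ea.
by apply: lt_trans ca; apply: cfix; split=> //; exact: tower_le (ltW ec) _ teu.
Qed.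

End Tower.

(** Stationarity provides an inaccessible fixed point [nu]; its regularity places each subset of
    size less than [nu] inside an earlier stage, so stage [nu] absorbs its value under [F]. *)
Lemma mahlo_closed_set k (F : set L -> set L) z B : mahlo k ->
  small k z -> (forall w, small k (F w)) ->
  z `<=` B -> (forall w, F w `<=` B) -> below k `<=` B ->
  exists C, [/\ z `<=` C, C `<=` B, small k C &
    exists nu, C `&` below k = below nu /\
      forall w, w `<=` C -> small nu w -> F w `<=` C].
Proof.
move=> [kinacc [_ kstat]] kz kF zB FB kB.
have [nu [[nuk [_ nureg _]] [_ nufix]]] :=
  kstat _ (tower_fixpoints_club kinacc kz kF).
exists (tower F z nu); split.
- by move=> u zu; exact: tower_base.
- exact: tower_sub nuk.
- exact: tower_small.
exists nu; split.
  apply/seteqP; split=> // u unu; split; first exact: tower_below.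
  exact: lt_trans nuk.
move=> w wC nuw u Fu.
have nu0 : below nu !=set0.
  apply/set0P/eqP => nu0; have [_ nuinf _] := nureg.
  by apply: nuinf; rewrite nu0.
have /choice[e eP] v : exists e, w v -> e < nu /\ tower F z e v.
  have [wv|nwv] := pselect (w v); last by exists nu.
  have [|e enu tev] := tower_limit nu0 _ (wC _ wv); last by exists e.
  by move=> b; exact: regular_limit.
have [||b bnu eb] := @small_bounded nu (e @` w) nureg.
- by move=> _ [v wv <-]; have [] := eP _ wv.
- exact: small_image.
apply: tower_step bnu _ Fu => v wv; have [_] := eP _ wv; apply: tower_le.
by apply/ltW/eb; exists v.
Qed.

(** * Hulls: closure under [F] on sets of size less than that of [D] *)

Definition closed_under (D : set L) (F : set L -> set L) (C : set L) : Prop :=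
  forall w, w `<=` C -> ~ (D #<= w) -> F w `<=` C.

Definition hull D F t : set L :=
  [set u | forall C, t `<=` C -> closed_under D F C -> C u].

Lemma sub_hull D F t : t `<=` hull D F t.
Proof. by move=> u tu C tC _; exact: tC. Qed.

Lemma hull_min D F t C : t `<=` C -> closed_under D F C -> hull D F t `<=` C.
Proof. by move=> tC CF u; apply. Qed.

Lemma hull_closed D F t : closed_under D F (hull D F t).
Proof.
move=> w wh Dw u Fu C tC CF; exact: CF (subset_trans wh (hull_min tC CF)) Dw _ Fu.
Qed.

(** Measuring size by a set [D] instead of an ordinal makes enlarging [D] only strengthen closure,
    so the hull for [D'] is also closed for [D]. *)
Lemma hull_mono D D' F t t' : D `<=` D' -> t `<=` t' ->
  hull D F t `<=` hull D' F t'.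
Proof.
move=> DD' tt'; apply: hull_min; first exact: subset_trans tt' (@sub_hull _ _ _).
move=> w wh Dw; apply: hull_closed wh _ => D'w; apply: Dw.
exact: card_le_trans (subset_card_le DD') D'w.
Qed.

(** * From [lambda] up to [lambda'] *)

Lemma one_stationary_lift kappa lambda lambda' (S : set (set L)) :
  mahlo kappa -> kappa <= lambda -> lambda < lambda' ->
  one_stationary kappa (below lambda) S ->
  one_stationary kappa (below lambda')
    (lift_Pk kappa (below lambda) (below lambda') S).
Proof.
move=> kmahlo kl ll' [SP Sstat]; split=> [y []//|T [TP Tunb]].
have [kinacc _] := kmahlo; have [_ kreg klim] := kinacc.
have [kcard kinf _] := kreg.
have kl' := le_lt_trans kl ll'.
have /choice[F FP] (w : set L) : exists G : set L, [/\ small kappa G,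
    G `<=` below lambda' & Pk kappa (below lambda') w ->
    exists t c, [/\ T t, w `<=` t, t `<=` G & [/\ G c, c < kappa & t #<= below c]]].
  have [wP|nwP] := pselect (Pk kappa (below lambda') w); last first.
    exists set0; split=> [||/nwP//]; last exact: sub0set.
    exact: small_finite.
  have [t Tt wt] := Tunb w wP; have [tl' /card_ltE kt] := TP _ Tt.
  have [c ck tc] := small_ex kt.
  exists (t `|` [set c]); split.
  - by apply: small_setU => //; exact/small_finite/finite_set1.
  - by move=> u [/tl'//|->]; exact: lt_trans kl'.
  - by move=> _; exists t, c; do !split=> //; right.
have kF w : small kappa (F w) by have [] := FP w.
have Fl' w : F w `<=` below lambda' by have [] := FP w.
pose D t : set L := t `&` below kappa.
pose T' : set (set L) := [set t | Pk kappa (below lambda) t /\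
  exists C, [/\ C `<=` below lambda', small kappa C, C `&` below lambda = t &
                closed_under (D t) F C]].
have T'unb : unbounded kappa (below lambda) T'.
  split=> [t []//|x [xl /card_ltE kx]].
  have xl' : x `<=` below lambda' by move=> u /xl ul; exact: lt_trans ll'.
  have [C [zC Cl' kC [nu [Cnu Ccl]]]] :=
    mahlo_closed_set kmahlo kx kF xl' Fl' (below_le (ltW kl')).
  (* As [kappa <= lambda], cutting [C] down to [lambda] keeps its trace on [kappa], so closure for
     [nu] is closure for [D] of the cut. *)
  have DE : D (C `&` below lambda) = below nu.
    rewrite -Cnu /D -setIA; congr (_ `&` _); apply/setIidr.
    exact: below_le.
  exists (C `&` below lambda); last by move=> u xu; split; [exact: zC|exact: xl].
  split; first split=> [u []//|].
    by apply/card_ltE; apply: small_subset kC => u [].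
  by exists C; split=> //; rewrite /closed_under DE.
have [x Sx [m [xm minacc [_ T'x]]]] := Sstat _ T'unb.
(* In the definitions [`&`] is the lattice meet of [set L], only convertible   *)
(* to the set intersection.                                                    *)
have {}xm : x `&` below kappa = below m := xm.
have [_ mreg mlim] := minacc; have [mcard minf _] := mreg.
have [xl /card_ltE kx] := SP _ Sx.
pose I := T' `&` Pk m x; pose h t := hull (D t) F t.
pose y := \bigcup_(t in I) h t.
have hP t : I t -> [/\ h t `<=` below lambda', small kappa (h t) &
    h t `&` below lambda `<=` x].
  move=> [[_ [C [Cl' kC Ct Ccl]]] [tx _]].
  (* [C] is closed for the same bound [D t], so it contains the hull and limits its size and its
     trace on [lambda]. *)
  have hC : h t `<=` C by apply: hull_min => // u; rewrite -Ct => -[].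
  split; first exact: subset_trans Cl'.
    exact: small_subset kC.
  by move=> u [/hC Cu ul]; apply: tx; rewrite -Ct.
have yl : y `&` below lambda = x.
  apply/seteqP; split=> [u [[t It hu] ul]|u xu].
    by have [_ _] := hP _ It; apply.
  split; last exact: xl.
  have [|t It ut] := T'x [set u].
    split; first by move=> _ ->.
    exact/card_ltE/small_finite/finite_set1.
  by exists t => //; apply: sub_hull; exact: ut.
have yk : y `&` below kappa = below m.
  rewrite -xm -yl -setIA; congr (_ `&` _); apply/esym/setIidr.
  exact: below_le.
have mx : below m `<=` x by rewrite -xm => u [].
have Sy : S (y `&` below lambda) by rewrite yl.
exists y.
  split; last exact: Sy.
  split; first by move=> u [t It hu]; have [+ _ _] := hP _ It; apply.
  apply/card_ltE/small_bigcup => // [|t /hP[]//].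
  (* The index set is small because [x] has few subsets, [kappa] being a strong limit. *)
  apply: small_subset (small_powerset klim kx) => t [_ []//].
exists m; split=> //; split=> [t []//|w [wy /card_ltE mw]].
have /choice[p pP] v : exists t, w v -> I t /\ h t v.
  have [wv|nwv] := pselect (w v); last by exists set0.
  by have [t It hv] := wy _ wv; exists t.
have [n nm nw] := limit_cardinal_small mlim mw.
(* Covering [below n] as well puts it inside [D t]; then [w], of size less than [n], is among the
   sets on which the hull of [t] is closed. *)
have [|t It Ut] := T'x (\bigcup_(v in w) p v `|` below n).
  split.
    move=> u [[v wv pu]|un]; first by have [[_ [+ _]] _] := pP _ wv; apply.
    by apply: mx; exact: lt_trans nm.
  apply/card_ltE/small_setU => //; last exact: small_below.
  apply: small_bigcup => // v wv.
  by have [[_ [_ /card_ltE]]] := pP _ wv.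
have wh : w `<=` h t.
  move=> v wv; have [_] := pP _ wv.
  have pt : p v `<=` t by move=> u pu; apply: Ut; left; exists v.
  by apply: hull_mono => // u [/pt].
have Fh : F w `<=` h t.
  apply: hull_closed wh _ => Dw; have [_] := nw; apply.
  apply: card_le_trans Dw; apply: subset_card_le => u un; split.
    by apply: Ut; right.
  have : (y `&` below kappa) u by rewrite yk; exact: lt_trans nm.
  by case.
have hy : h t `<=` y by move=> u hu; exists t.
have [_ hk ht] := hP _ It.
have [_ _ [|t' [c [Tt' wt' t'F [Fc ck t'c]]]]] := FP w.
  have [hl' _ _] := hP _ It; split; first exact: subset_trans wh hl'.
  by apply/card_ltE; apply: small_subset hk.
exists t' => //; split=> //; split.
  exact: subset_trans t'F (subset_trans Fh hy).
(* The bound [c] lies in [F w], hence in [y] and below [m]. *)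
apply/card_ltE; apply: small_le t'c _; apply: small_below => //.
have : (y `&` below kappa) c by split=> //; apply: hy; exact: Fh.
by rewrite yk.
Qed.

(** * From [lambda'] down to [lambda] *)

Lemma one_stationary_unlift kappa lambda lambda' (S : set (set L)) :
  S `<=` Pk kappa (below lambda) ->
  kappa <= lambda -> regular_cardinal kappa -> lambda <= lambda' ->
  one_stationary kappa (below lambda')
    (lift_Pk kappa (below lambda) (below lambda') S) ->
  one_stationary kappa (below lambda) S.
Proof.
move=> SP kl kreg ll' [_ Sstat]; split=> // T [TP Tunb].
have [] := Sstat (lift_Pk kappa (below lambda) (below lambda') T).
  split=> [y []//|x [xl' /card_ltE kx]].
  have [|t Tt xt] := Tunb (x `&` below lambda).
    split; first by move=> u [].
    by apply/card_ltE; apply: small_subset kx => u [].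
  have [tl /card_ltE kt] := TP _ Tt.
  (* [t] already contains the trace of [x] on [lambda], so adding [x] leaves the trace equal to
     [t]. *)
  exists (t `|` x); last by move=> u; right.
  split; first split.
  - by move=> u [/tl ul|/xl'//]; exact: lt_le_trans ll'.
  - by apply/card_ltE; exact: small_setU.
  suff tE : (t `|` x) `&` below lambda = t.
    by have : T ((t `|` x) `&` below lambda) by rewrite tE.
  apply/seteqP; split=> [u [[//|xu] ul]|u tu]; first exact: xt.
  by split; [left|exact: tl].
move=> y [_ Sy] [m [ym minacc [_ Ty]]].
have {}ym : y `&` below kappa = below m := ym.
exists (y `&` below lambda) => //.
exists m; split=> //.
  have /setIidr lk := below_le kl.
  by rewrite -ym -[in RHS]lk setIA.
split=> [t []//|z [zy mz]].
(* [z] is itself a small subset of [y]; since it lies below [lambda], the trace of its cover still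
   contains it. *)
have [|t [[_ Tt] [ty mt]] zt] := Ty z.
  by split=> // u /zy[].
exists (t `&` below lambda).
  split=> //; split; first by move=> u [/ty].
  by apply/card_ltE; move/card_ltE: mt; apply: small_subset => u [].
by move=> u zu; split; [exact: zt|have [] := zy _ zu].
Qed.

End WellOrdered.

Theorem theorem4p6 (d : Order.disp_t) (L : orderType d)
  (wo_L : well_order (<=%O : rel L))
  (kappa lambda lambda' : L)
  (mahlo_kappa : mahlo kappa)
  (card_lambda : is_cardinal lambda) (card_lambda' : is_cardinal lambda')
  (le_kappa_lambda : kappa <= lambda) (lt_lambda_lambda' : lambda < lambda')
  (S : set (set L)) (sub_S : S `<=` Pk kappa (below lambda)) :
  one_stationary kappa (below lambda) S <->
  one_stationary kappa (below lambda')
    (lift_Pk kappa (below lambda) (below lambda') S).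
Proof.
have [[_ kreg _] _] := mahlo_kappa; split; first exact: one_stationary_lift.
exact: one_stationary_unlift (ltW lt_lambda_lambda').
Qed.
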